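(* Let $T=(X,w)$ be a finite weighted rooted tree with root $x_0$ and tree distance $d$. For $\xi\in M_0(X)$ put $\Xi(x)=\sum_{y\succeq x}\xi(y)$, $x\in X$. Then, for every $\xi\in M_0(X)$, $$\|\xi\|_{\text{Æ}}=\sum_{x\in X\setminus\{x_0\}} d(x,x^+)\,|\Xi(x)| .$$ An equivalent expression of the norm is $$\|\xi\|_{\text{Æ}}=\sum_{y\in X}\xi(y)\sum_{x_0\neq x\preceq y} d(x,x^+)\,\operatorname{Sgn}\Xi(x),$$ where $\operatorname{Sgn}(\cdot)\in\{-1,1\}$ is a sign function, taking at zero either the value $\operatorname{Sgn}(0)=+1$ or $\operatorname{Sgn}(0)=-1$.
   Context: A weight $w$ on a finite set $X$ is a symmetric map $X\times X\to[0,\infty)$; its support defines an undirected simple graph on $X$ with edges $\{x,y\}$ such that $w(x,y)>0$ (no loops), assumed connected. The length of a path is the sum of the weights of its edges, and $d(x,y)$ is the length of a shortest path joining $x$ and $y$. A weighted tree is such a connected graph without cycles. Given a root $x_0$, the unique parent of $x\neq x_0$ (the neighbour of $x$ on the path from $x$ to $x_0$) is denoted $x^+$. The order $x\preceq y$ (equivalently $y\succeq x$) means that $x$ lies on the path from the root $x_0$ to $y$ (so $x=y$ is allowed and $x_0$ is the least element). $M_0(X)$ is the vector space of functions $\xi:X\to\mathbb R$ with $\sum_{x\in X}\xi(x)=0$. The Arens–Eells norm on $M_0(X)$ is $$\|\xi\|_{\text{Æ}}=\inf\Big\{\sum_{x,y\in X}|a(x,y)|\,d(x,y)\ :\ a\in\mathbb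 R^{X\times X},\ \xi=\sum_{x,y\in X}a(x,y)(\delta_x-\delta_y)\Big\},$$ where $\delta_x$ is the indicator function of $\{x\}$. *)

(* Defs.v *)
From HB Require Import structures.
From mathcomp Require Import all_boot all_order all_algebra.
From mathcomp Require Import boolp classical_sets reals.

Set Implicit Arguments.
Unset Strict Implicit.
Unset Printing Implicit Defensive.

Import Order.TTheory GRing.Theory Num.Theory.

Local Open Scope classical_set_scope.
Local Open Scope ring_scope.

Definition is_weight (R : realType) (X : finType) (w : X -> X -> R) : Prop :=
  (forall x y, w x y = w y x) /\ (forall x y, 0 <= w x y).

(* The diagonal of a weight is unconstrained: loops are simply not edges. *)
Definition edge (R : realType) (X : finType) (w : X -> X -> R) : rel X :=
  fun x y => (x != y) && (0 < w x y).

Definition simple_path (X : finType) (e : rel X) (x y : X) (p : seq X) : bool :=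
  [&& path e x p, last x p == y & uniq (x :: p)].

Definition connected_graph (X : finType) (e : rel X) : Prop :=
  forall x y, exists p, simple_path e x y p.

(* [ucycle e [:: x; y]] holds for every edge of a symmetric [e], hence the
   bound 2: genuine cycles have at least three vertices. *)
Definition acyclic_graph (X : finType) (e : rel X) : Prop :=
  forall c : seq X, ucycle e c -> (size c <= 2)%N.

Definition weighted_tree (R : realType) (X : finType) (w : X -> X -> R) : Prop :=
  [/\ is_weight w, connected_graph (edge w) & acyclic_graph (edge w)].

Definition path_length (R : realType) (X : finType) (w : X -> X -> R)
    (x : X) (p : seq X) : R :=
  \sum_(l <- pairmap w x p) l.

(* There are finitely many simple paths, so on a connected graph this infimum
   is a minimum. *)
Definition graph_dist (R : realType) (X : finType) (w : X -> X -> R)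
    (x y : X) : R :=
  inf [set path_length w x p | p in [set p | simple_path (edge w) x y p]].

(* [z] lies on a simple path from [x] to [y]; in a tree that path is unique. *)
Definition on_path (R : realType) (X : finType) (w : X -> X -> R)
    (x y z : X) : bool :=
  `[< exists2 p, simple_path (edge w) x y p & z \in x :: p >].

Definition tree_le (R : realType) (X : finType) (w : X -> X -> R)
    (x0 x y : X) : bool :=
  on_path w x0 y x.

(* The default value [x] of the [pick] is only taken at the root of a tree. *)
Definition parent (R : realType) (X : finType) (w : X -> X -> R)
    (x0 x : X) : X :=
  odflt x [pick y | edge w x y && on_path w x x0 y].

Definition M0 (R : realType) (X : finType) : set (X -> R) :=
  [set xi | \sum_x xi x = 0].
Arguments M0 : clear implicits.

Definition delta (R : realType) (X : finType) (x : X) : X -> R :=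
  fun z => (z == x)%:R.
Arguments delta R {X} x.

Definition AE_norm (R : realType) (X : finType) (w : X -> X -> R)
    (xi : X -> R) : R :=
  inf [set \sum_x \sum_y `|a x y| * graph_dist w x y
      | a in [set a : X -> X -> R |
              forall z, xi z =
                \sum_x \sum_y a x y * (delta R x z - delta R y z)]].

Definition subtree_sum (R : realType) (X : finType) (w : X -> X -> R) (x0 : X)
    (xi : X -> R) (x : X) : R :=
  \sum_(y | tree_le w x0 x y) xi y.

Definition is_sign_function (R : realType) (Sgn : R -> R) : Prop :=
  [/\ forall t, 0 < t -> Sgn t = 1,
      forall t, t < 0 -> Sgn t = -1
    & Sgn 0 = 1 \/ Sgn 0 = -1].

(* Main.v *)
(** Telescoping along the path from the root [x0] to [y] gives
    [delta_y - delta_x0 = \sum_(x0 <> x <= y) (delta_x - delta_x^+)], so that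
    summation against [xi] represents [xi] by [a (x, x^+) = Xi x]: this is the
    upper bound.  Conversely, if [a] represents [xi], then
    [Xi x = \sum_(u, v) a u v * (1_(x <= u) - 1_(x <= v))], and the weighted cut
    semimetric [\sum_x d(x, x^+) * |1_(x <= u) - 1_(x <= v)|] is at most
    [d(u, v)], because on an edge [{x, x^+}] only the term of [x] survives. *)
Require Import Defs.
From mathcomp Require Import all_boot all_order all_algebra.
From mathcomp Require Import boolp classical_sets reals.

Set Implicit Arguments.
Unset Strict Implicit.
Unset Printing Implicit Defensive.

Import Order.TTheory GRing.Theory Num.Theory.

Local Open Scope classical_set_scope.
Local Open Scope ring_scope.

(** * Simple paths in acyclic graphs *)

Lemma last_rev_belast (T : Type) (x : T) (p : seq T) :
  last (last x p) (rev (belast x p)) = x.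
Proof. by case: p => //= y p; rewrite rev_cons last_rcons. Qed.

Lemma simple_path_rev (X : finType) (e : rel X) (x y : X) (p : seq X) :
  symmetric e -> simple_path e x y p -> simple_path e y x (rev (belast x p)).
Proof.
move=> eC /and3P[ep /eqP <- up]; apply/and3P; split.
- by rewrite rev_path (@eq_path _ _ e) // => a b /=; rewrite eC.
- by rewrite last_rev_belast.
- by rewrite -rev_rcons -lastI rev_uniq.
Qed.

(* Two paths leaving [x] through distinct neighbours [a] and [b] would yield a
   path from [a] to [b] avoiding [x], hence a cycle through [x], [a] and [b]. *)
Lemma simple_path_unique (X : finType) (e : rel X) (x y : X) (p q : seq X) :
  symmetric e -> acyclic_graph e ->
  simple_path e x y p -> simple_path e x y q -> p = q.
Proof.
move=> eC eA; elim: p x q => [|a p IHp] x [|b q] //.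
- move=> /and3P[_ /= /eqP xy _] /and3P[_ /= /eqP qy /andP[xq _]].
  by rewrite xy -qy mem_last in xq.
- move=> /and3P[_ /= /eqP py /andP[xp _]] /and3P[_ /= /eqP xy _].
  by rewrite xy -py mem_last in xp.
move=> /and3P[/= /andP[xa ep] /eqP py /andP[xp up]].
move=> /and3P[/= /andP[xb eq] /eqP qy /andP[xq uq]].
have [ab|nab] := eqVneq a b.
  by rewrite -ab in eq qy uq *; rewrite (IHp a q) //; apply/and3P; split=> //; apply/eqP.
have eq' : path e y (rev (belast b q)).
  by rewrite -qy rev_path (@eq_path _ _ e) // => c d /=; rewrite eC.
have er : path e a (p ++ rev (belast b q)) by rewrite cat_path ep py.
have lr : last a (p ++ rev (belast b q)) = b.
  by rewrite last_cat py -qy last_rev_belast.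
have xr : x \notin a :: (p ++ rev (belast b q)).
  rewrite -cat_cons mem_cat negb_or xp mem_rev.
  by apply: contra xq => /mem_belast.
(* Removing repetitions turns the walk from [a] to [b] into a simple path whose vertices are among
   the old ones, so it still avoids [x]. *)
case/shortenP: er lr => r er ur sr lr.
have /eA : ucycle e (x :: a :: r).
  rewrite /ucycle /ucycleb /= xa rcons_path er lr eC xb /=.
  rewrite /= in ur; rewrite ur andbT.
  apply: contra xr; rewrite !inE => /orP[->//|/sr ->]; exact: orbT.
case: r lr {er ur sr} => //= ba; by rewrite ba eqxx in nab.
Qed.

(** * Root paths, the tree order and parents *)

Section RootedTree.
Variables (R : realType) (X : finType) (w : X -> X -> R) (x0 : X).
Hypothesis wT : weighted_tree w.

Let conn : connected_graph (edge w). Proof. by case: wT. Qed.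
Let acyc : acyclic_graph (edge w). Proof. by case: wT. Qed.

Lemma edge_sym : symmetric (edge w).
Proof. by case: wT => -[wC _] _ _ x y; rewrite /edge eq_sym wC. Qed.

Let path_unique x y p q := @simple_path_unique _ _ x y p q edge_sym acyc.

(** The choice is harmless, since simple paths are unique; it turns the tree order into membership
    in a list. *)
Definition root_path (y : X) : seq X := xchoose (conn x0 y).

Lemma root_pathP y : simple_path (edge w) x0 y (root_path y).
Proof. exact: xchooseP (conn x0 y). Qed.

Lemma root_pathE y p : simple_path (edge w) x0 y p -> root_path y = p.
Proof. exact/path_unique/root_pathP. Qed.

Lemma last_root_path y : last x0 (root_path y) = y.
Proof. by have /and3P[_ /eqP] := root_pathP y. Qed.

Lemma root_path_inj : injective root_path.
Proof. by move=> u v uv; rewrite -(last_root_path u) uv last_root_path. Qed.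

Lemma uniq_root_path y : uniq (x0 :: root_path y).
Proof. by have /and3P[] := root_pathP y. Qed.

Lemma tree_leE x y : tree_le w x0 x y = (x \in x0 :: root_path y).
Proof.
apply/asboolP/idP => [[p /root_pathE ->]//|xy].
by exists (root_path y) => //; exact: root_pathP.
Qed.

Lemma on_path_to_root x y : on_path w x x0 y = tree_le w x0 y x.
Proof.
have mem_revp u v p : last u p = v ->
    (y \in v :: rev (belast u p)) = (y \in u :: p).
  by move=> <-; rewrite -rev_rcons -lastI mem_rev.
apply/asboolP/asboolP => -[p sp yp]; have /and3P[_ /eqP lp _] := sp.
- by exists (rev (belast x p)); [exact: simple_path_rev edge_sym sp|rewrite mem_revp].
- by exists (rev (belast x0 p)); [exact: simple_path_rev edge_sym sp|rewrite mem_revp].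
Qed.

(** If [v] is off the root path of [u], appending [v] keeps that path simple. Otherwise cut the path
    at [v]: the tail from [v] to [u] is a simple path, so by uniqueness it is the single edge. *)
Lemma edge_root_path u v : edge w u v ->
  root_path v = rcons (root_path u) v \/ root_path u = rcons (root_path v) u.
Proof.
move=> uv; have /and3P[eu /eqP lu uu] := root_pathP u.
have [vu|vu] := boolP (v \in x0 :: root_path u); last first.
  left; apply: root_pathE; apply/and3P; split.
  - by rewrite rcons_path eu lu.
  - by rewrite last_rcons.
  - by rewrite -rcons_cons rcons_uniq vu.
right; move: (root_path u) vu eu lu uu => _ /splitPl[p1 p2 lp1].
rewrite cat_path lp1 last_cat lp1 -cat_cons cat_uniq.
move=> /andP[e1 e2] l2 /and3P[u1 no12 u2].
have -> : root_path v = p1.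
  by apply: root_pathE; apply/and3P; split=> //; apply/eqP.
suff -> : p2 = [:: u] by rewrite cats1.
apply: (@path_unique v u).
  apply/and3P; split; [by []|by apply/eqP|].
  rewrite /= u2 andbT; apply: contra no12 => vp2.
  by apply/hasP; exists v => //=; rewrite -lp1 mem_last.
have vu : edge w v u by rewrite edge_sym.
by apply/and3P; split; rewrite /= ?vu ?inE ?andbT //; case/andP: vu.
Qed.

Lemma parentP x : x != x0 ->
  edge w x (parent w x0 x) /\ root_path x = rcons (root_path (parent w x0 x)) x.
Proof.
move=> xx0; rewrite /parent; case: pickP => [y /andP[xy]|noy] /=.
  rewrite on_path_to_root tree_leE => yx; split=> //.
  (* The other orientation would make [y] occur twice on its own root path. *)
  have [yE|//] := edge_root_path xy.
  have := uniq_root_path y.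
  by rewrite yE -rcons_cons rcons_uniq yx.
have /and3P[+ + +] := root_pathP x.
case/lastP E: (root_path x) => [|p z].
  by move=> _ /eqP /= x0x; rewrite x0x eqxx in xx0.
rewrite rcons_path last_rcons => /andP[_ lz] /eqP zx _; rewrite zx in lz E.
(* The penultimate vertex of the root path of [x] is a witness, so the [pick] cannot fail away from
   the root. *)
have := noy (last x0 p); rewrite edge_sym lz on_path_to_root tree_leE E.
by rewrite -rcons_cons mem_rcons in_cons mem_last orbT.
Qed.

Lemma parent_root_path u v : root_path v = rcons (root_path u) v ->
  v != x0 /\ parent w x0 v = u.
Proof.
move=> vE; have vx0 : v != x0.
  apply/eqP => vx0; have := uniq_root_path v.
  by rewrite vE -rcons_cons rcons_uniq -vx0 mem_head.
split=> //; have [_] := parentP vx0.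
by rewrite vE => /rcons_inj[/root_path_inj].
Qed.

Lemma strict_tree_leE x y : (x != x0) && tree_le w x0 x y = (x \in root_path y).
Proof.
rewrite tree_leE in_cons; case: eqVneq => [->|//] /=.
by have /andP[/negbTE ->] := uniq_root_path y.
Qed.

Lemma sum_root_path (f : X -> R) y :
  \sum_(x | (x != x0) && tree_le w x0 x y) f x = \sum_(x <- root_path y) f x.
Proof.
rewrite (eq_bigl _ _ (strict_tree_leE^~ y)) big_uniq //.
by have /andP[] := uniq_root_path y.
Qed.

Lemma telescope_root_path (f : X -> R) y :
  \sum_(x | (x != x0) && tree_le w x0 x y) (f x - f (parent w x0 x)) =
  f y - f x0.
Proof.
rewrite sum_root_path.
(* Induction on the depth of [y]: passing to the parent removes the last vertex of the root path. *)
have [n] := ubnP (size (root_path y)); elim: n y => // n IHn y.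
have [->|yx0] := eqVneq y x0.
  by rewrite (@root_pathE x0 [::]) ?big_nil ?subrr // /simple_path /= eqxx.
have [_ ->] := parentP yx0; rewrite size_rcons ltnS => /IHn.
by rewrite big_rcons /= => ->; rewrite addrC subrKA.
Qed.

(** * Bounds on the path distance *)

Lemma path_length_ge0 x p : 0 <= path_length w x p.
Proof.
case: wT => -[_ w0] _ _; rewrite /path_length.
by elim: p x => [|y p IHp] x; rewrite /= ?big_nil // big_cons addr_ge0.
Qed.

Lemma graph_dist_le x y p : simple_path (edge w) x y p ->
  graph_dist w x y <= path_length w x p.
Proof.
move=> sp; apply: ge_inf; last by exists p.
by exists 0 => _ [q _ <-]; exact: path_length_ge0.
Qed.

(** The bound is asked of all walks, not only simple ones, so that an induction along the walk need
    not carry [uniq]. *)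
Lemma le_graph_dist x y r :
  (forall p, path (edge w) x p -> last x p = y -> r <= path_length w x p) ->
  r <= graph_dist w x y.
Proof.
move=> rP; apply: lb_le_inf.
  by have [p sp] := conn x y; exists (path_length w x p), p.
by move=> _ [p /and3P[ep /eqP lp _] <-]; exact: rP.
Qed.

Lemma graph_dist_ge0 x y : 0 <= graph_dist w x y.
Proof. by apply: le_graph_dist => p _ _; exact: path_length_ge0. Qed.

Lemma graph_dist_edge x y : edge w x y -> graph_dist w x y <= w x y.
Proof.
move=> xy; have -> : w x y = path_length w x [:: y].
  by rewrite /path_length /= big_seq1.
apply: graph_dist_le; apply/and3P; split; rewrite /= ?xy ?inE ?andbT //.
by case/andP: xy.
Qed.

(** * The cut semimetric, a weighted l1 distance between indicators of root paths *)

Definition cut_dist (u v : X) : R :=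
  \sum_(x | x != x0) graph_dist w x (parent w x0 x) *
    `|(tree_le w x0 x u)%:R - (tree_le w x0 x v)%:R|.

Lemma cut_distC u v : cut_dist u v = cut_dist v u.
Proof. by apply: eq_bigr => x _; rewrite distrC. Qed.

Lemma cut_dist_triangle u v z : cut_dist u z <= cut_dist u v + cut_dist v z.
Proof.
rewrite -big_split /=; apply: ler_sum => x _.
by rewrite -mulrDr ler_wpM2l ?graph_dist_ge0 ?ler_distD.
Qed.

(** The root path of [x] is that of its parent followed by [x], so the two indicators differ at [x]
    only. *)
Lemma cut_dist_parent x : x != x0 ->
  cut_dist x (parent w x0 x) = graph_dist w x (parent w x0 x).
Proof.
move=> xx0; have [_ xE] := parentP xx0.
have xNp : x \notin x0 :: root_path (parent w x0 x).
  by have := uniq_root_path x; rewrite xE -rcons_cons rcons_uniq => /andP[].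
rewrite /cut_dist (bigD1 x) //= big1 ?addr0 => [|y /andP[_ yx]].
  rewrite !tree_leE (negbTE xNp) xE -rcons_cons mem_rcons mem_head.
  by rewrite subr0 normr1 mulr1.
rewrite !tree_leE xE -rcons_cons mem_rcons [y \in x :: _]in_cons (negbTE yx) /=.
by rewrite subrr normr0 mulr0.
Qed.

Lemma cut_dist_edge u v : edge w u v -> cut_dist u v <= w u v.
Proof.
case: (wT) => -[wC _] _ _ uv.
have [/parent_root_path[vx0 <-]|/parent_root_path[ux0 <-]] := edge_root_path uv.
- by rewrite cut_distC cut_dist_parent // wC graph_dist_edge //; case: (parentP vx0).
- by rewrite cut_dist_parent // graph_dist_edge //; case: (parentP ux0).
Qed.

(** The triangle inequality along a walk reduces the bound to single edges. *)
Lemma cut_dist_le u v : cut_dist u v <= graph_dist w u v.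
Proof.
apply: le_graph_dist => p; elim: p u => [|z p IHp] u /=.
  move=> _ ->; rewrite /path_length /= big_nil.
  by rewrite /cut_dist big1 // => x _; rewrite subrr normr0 mulr0.
move=> /andP[uz zp] lp; rewrite /path_length /= big_cons.
apply: le_trans (cut_dist_triangle u z v) _.
by apply: lerD; [exact: cut_dist_edge|exact: IHp].
Qed.

(** * Subtree sums and the flow they define *)

Lemma subtree_sum_delta (a : X -> X -> R) (xi : X -> R) x :
  (forall z, xi z = \sum_u \sum_v a u v * (delta R u z - delta R v z)) ->
  subtree_sum w x0 xi x =
  \sum_u \sum_v a u v * ((tree_le w x0 x u)%:R - (tree_le w x0 x v)%:R).
Proof.
move=> aP; have sum_delta u : \sum_(z | tree_le w x0 x z) delta R u z =
    (tree_le w x0 x u)%:R.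
  rewrite -natr_sum big_mkcond /= (bigD1 u) //= eqxx big1 ?addn0.
    by case: ifP.
  by move=> z /negbTE ->; rewrite if_same.
rewrite /subtree_sum (eq_bigr _ (fun z _ => aP z)) exchange_big /=.
apply: eq_bigr => u _; rewrite exchange_big /=; apply: eq_bigr => v _.
by rewrite -mulr_sumr sumrB !sum_delta.
Qed.

(** Exchange of summation over the pairs [x] below [y]. It yields both the flow representation of
    [xi] and the signed form of the norm. *)
Lemma sum_subtree_sum (f xi : X -> R) :
  \sum_(x | x != x0) f x * subtree_sum w x0 xi x =
  \sum_y xi y * \sum_(x | (x != x0) && tree_le w x0 x y) f x.
Proof.
under eq_bigr do rewrite mulr_sumr.
rewrite (exchange_big_dep xpredT) //=; apply: eq_bigr => y _.
by rewrite mulr_sumr; apply: eq_bigr => x _; rewrite mulrC.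
Qed.

Lemma subtree_sum_flow (xi : X -> R) z : M0 R X xi ->
  xi z = \sum_(x | x != x0)
    (delta R x z - delta R (parent w x0 x) z) * subtree_sum w x0 xi x.
Proof.
move=> xi0; rewrite sum_subtree_sum.
under eq_bigr do rewrite (telescope_root_path (fun x => delta R x z)) mulrBr.
(* The root term of the telescoped sums carries the total mass of [xi], which is zero. *)
rewrite sumrB -mulr_suml xi0 mul0r subr0 (bigD1 z) //= /delta eqxx mulr1.
by rewrite big1 ?addr0 // => y yz; rewrite eq_sym (negbTE yz) mulr0.
Qed.

(** * Lower bound, attainment and the norm formula *)

Lemma AE_norm_lower (a : X -> X -> R) (xi : X -> R) :
  (forall z, xi z = \sum_u \sum_v a u v * (delta R u z - delta R v z)) ->
  \sum_(x | x != x0)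
    graph_dist w x (parent w x0 x) * `|subtree_sum w x0 xi x| <=
  \sum_u \sum_v `|a u v| * graph_dist w u v.
Proof.
move=> aP; apply: (@le_trans _ _ (\sum_u \sum_v `|a u v| * cut_dist u v)).
  (* With the sum over [x] moved outside, it suffices to bound the absolute subtree sum at each [x]
     by the total absolute flow across the cut at [x]. *)
  under [leRHS]eq_bigr do under eq_bigr do rewrite mulr_sumr.
  under [leRHS]eq_bigr do rewrite exchange_big /=.
  rewrite exchange_big /=; apply: ler_sum => x _.
  under eq_bigr do under eq_bigr do rewrite mulrCA.
  under eq_bigr do rewrite -mulr_sumr.
  rewrite -mulr_sumr ler_wpM2l ?graph_dist_ge0 // (subtree_sum_delta x aP).
  apply: le_trans (ler_norm_sum _ _ _) _; apply: ler_sum => u _.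
  apply: le_trans (ler_norm_sum _ _ _) _; apply: ler_sum => v _.
  by rewrite normrM.
by do 2![apply: ler_sum => ? _]; rewrite ler_wpM2l ?cut_dist_le.
Qed.

Lemma AE_normE (xi : X -> R) : M0 R X xi ->
  AE_norm w xi = \sum_(x | x != x0)
    graph_dist w x (parent w x0 x) * `|subtree_sum w x0 xi x|.
Proof.
move=> xi0; rewrite /AE_norm; set S := [set _ | _ in _].
(* The optimal transport: each vertex sends its subtree sum to its parent. *)
pose a x y : R :=
  if (x != x0) && (y == parent w x0 x) then subtree_sum w x0 xi x else 0.
(* Stated for general [F] to serve both the representation of [xi] and its cost; [F 0 x y = 0]
   discards the pairs that are not child and parent. *)
have sum_a (F : R -> X -> X -> R) : (forall x y, F 0 x y = 0) ->
    \sum_x \sum_y F (a x y) x y = \sum_(x | x != x0)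
      F (subtree_sum w x0 xi x) x (parent w x0 x).
  move=> F0; rewrite [RHS]big_mkcond; apply: eq_bigr => x _ /=.
  rewrite /a (bigD1 (parent w x0 x)) //= eqxx andbT big1 ?addr0.
    by case: ifP.
  by move=> y /negbTE ->; rewrite andbF.
have Sa : S (\sum_(x | x != x0)
    graph_dist w x (parent w x0 x) * `|subtree_sum w x0 xi x|).
  exists a => [z|] /=.
    rewrite (sum_a (fun c x y => c * (delta R x z - delta R y z))).
      by rewrite {1}(subtree_sum_flow z xi0); apply: eq_bigr => x _; rewrite mulrC.
    by move=> x y; rewrite mul0r.
  rewrite (sum_a (fun c x y => `|c| * graph_dist w x y)).
    by apply: eq_bigr => x _; rewrite mulrC.
  by move=> x y; rewrite normr0 mul0r.
have lbS : lbound S (\sum_(x | x != x0)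
    graph_dist w x (parent w x0 x) * `|subtree_sum w x0 xi x|).
  by move=> _ [b bP <-]; exact: AE_norm_lower.
(* The value belongs to [S] and bounds it below; these facts also make [S] nonempty and bounded, as
   the infimum lemmas require. *)
apply/le_anti/andP; split.
- by apply: ge_inf => //; eexists; exact: lbS.
- by apply: lb_le_inf => //; eexists; exact: Sa.
Qed.

End RootedTree.

(** * The signed form of the norm *)

Lemma mul_sign_function (R : realType) (Sgn : R -> R) (t : R) :
  is_sign_function Sgn -> Sgn t * t = `|t|.
Proof.
(* At zero the factor [t] makes both sides vanish, so both conventions for [Sgn 0] give the same
   norm. *)
case=> Sp Sn _; case: (ltgtP t 0) => [t0|t0|->]; last by rewrite mulr0 normr0.
- by rewrite Sn // mulN1r ltr0_norm.
- by rewrite Sp // mul1r gtr0_norm.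
Qed.

Theorem theorem4 (R : realType) (X : finType) (w : X -> X -> R) (x0 : X)
    (wT : weighted_tree w) (xi : X -> R) (xi0 : M0 R X xi) :
  AE_norm w xi =
    \sum_(x | x != x0)
      graph_dist w x (parent w x0 x) * `|subtree_sum w x0 xi x|
  /\
  forall Sgn : R -> R, is_sign_function Sgn ->
    AE_norm w xi =
      \sum_y xi y *
        \sum_(x | (x != x0) && tree_le w x0 x y)
          graph_dist w x (parent w x0 x) * Sgn (subtree_sum w x0 xi x).
Proof.
split=> [|Sgn SgnP]; first exact: AE_normE.
rewrite (AE_normE x0 wT xi0) -sum_subtree_sum; apply: eq_bigr => x _.
by rewrite -mulrA mul_sign_function.
Qed.
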